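(* Fix any $\lambda>0$ and $\mu>0$. For $(U,V)\in\mathbb{R}^{n\times r}\times\mathbb{R}^{m\times r}$ let $$F_\mu(U,V)=f(UV^{\mathbb{T}})+\frac{\mu}{2}\big(\|U\|_F^2+\|V\|_F^2\big),\qquad \Phi_{\lambda,\mu}(U,V)=F_\mu(U,V)+\lambda\big(\|U\|_{2,0}+\|V\|_{2,0}\big).$$ Then $\mathrm{crit}\,\Phi_{\lambda,\mu}=\mathrm{crit}\,F_\mu$, which means that every $(\overline{U},\overline{V})\in\mathrm{crit}\,\Phi_{\lambda,\mu}$ satisfies $\overline{U}^{\mathbb{T}}\overline{U}=\overline{V}^{\mathbb{T}}\overline{V}$ and $\sigma(\overline{U})=\sigma(\overline{V})$. In addition, every global minimizer $(\overline{U}^*,\overline{V}^* )$ of $\Phi_{\lambda,\mu}$ also satisfies $$\mathrm{rank}(\overline{U}^* )=\|\overline{U}^*\|_{2,0}=\|\overline{V}^*\|_{2,0}=\mathrm{rank}(\overline{V}^* ).$$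
   Context: Standing assumptions: $n\le m$, $r$ is a positive integer with $r\le n$; $f:\mathbb{R}^{n\times m}\to\mathbb{R}_+$ is smooth (continuously differentiable) and $\nabla f$ is Lipschitz continuous with modulus $L_f$. $\|Z\|_{2,0}$ is the number of nonzero columns of $Z$; $\sigma(Z)$ is the vector of singular values of $Z$ in nonincreasing order (here the $r$ singular values of an $n\times r$ or $m\times r$ matrix). For a function $h$, $\mathrm{crit}\,h$ is the set of points $x$ with $0\in\partial h(x)$, where $\partial h$ is the limiting subdifferential: $\partial h(x)=\{v:\exists x^k\to x,\ h(x^k)\to h(x),\ v^k\in\widehat{\partial}h(x^k),\ v^k\to v\}$ with regular subdifferential $\widehat{\partial}h(x)=\{v:\liminf_{x'\to x,\,x'\ne x}\frac{h(x')-h(x)-\langle v,x'-x\rangle}{\|x'-x\|}\ge 0\}$; for smooth $h$, $\mathrm{crit}\,h=\{x:\nabla h(x)=0\}$. *)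

(* Defs.v *)
From HB Require Import structures.
From mathcomp Require Import all_boot all_order all_algebra.
From mathcomp Require Import complex.
From mathcomp Require Import all_classical all_reals all_analysis.

Set Implicit Arguments.
Unset Strict Implicit.
Unset Printing Implicit Defensive.

Import Order.TTheory GRing.Theory Num.Theory.
Import numFieldNormedType.Exports.

Local Open Scope classical_set_scope.
Local Open Scope ring_scope.

Section Euclidean.
Context {R : realType}.

Definition mxdot p q (A B : 'M[R]_(p, q)) : R := \tr (A^T *m B).

(* MathComp-Analysis norms ['M_(p, q)] by the maximum norm; the Frobenius norm
   gives the same topology, but not the same Lipschitz constants. *)
Definition frob p q (A : 'M[R]_(p, q)) : R := Num.sqrt (mxdot A A).

Definition pairdot n m r (x y : 'M[R]_(n, r) * 'M[R]_(m, r)) : R :=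
  mxdot x.1 y.1 + mxdot x.2 y.2.

Definition pairnorm n m r (x : 'M[R]_(n, r) * 'M[R]_(m, r)) : R :=
  Num.sqrt (pairdot x x).

Definition mxgrad p q (f : 'M[R]_(p, q) -> R) (X : 'M[R]_(p, q)) :
    'M[R]_(p, q) :=
  \matrix_(i, j) 'D_(delta_mx i j) f X.

Definition C1 p q (f : 'M[R]_(p, q) -> R) : Prop :=
  (forall X, differentiable f X) /\ continuous (mxgrad f).

Definition lipschitz_grad p q (L : R) (f : 'M[R]_(p, q) -> R) : Prop :=
  forall X Y, frob (mxgrad f X - mxgrad f Y) <= L * frob (X - Y).

End Euclidean.

Section Subdifferential.
Context {R : realType} {n m r : nat}.
Notation E := ('M[R]_(n, r) * 'M[R]_(m, r))%type.

Definition regular_subdiff (h : E -> R) (x : E) : set E :=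
  [set v | (0 <= limf_einf
     (fun y : E => ((h y - h x - pairdot v (y - x)) / pairnorm (y - x))%:E)
     x^')%E].

Definition limiting_subdiff (h : E -> R) (x : E) : set E :=
  [set v | exists xk vk : nat -> E,
     [/\ xk @ \oo --> x,
         h (xk k) @[k --> \oo] --> h x,
         (forall k, regular_subdiff h (xk k) (vk k)) &
         vk @ \oo --> v]].

Definition crit (h : E -> R) : set E := [set x | limiting_subdiff h x 0].

Definition global_minimizer (h : E -> R) (x : E) : Prop :=
  forall y, h x <= h y.

End Subdifferential.

Section SingularValues.
Context {R : realType}.

(* The square roots of the eigenvalues of [Z^T *m Z], with multiplicity.  The
   spectral theorem of MathComp is over a closed field, hence the detour
   through [R[i]]; see [sigma_char_poly], [sigma_ge0], [sigma_nonincreasing]. *)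
Definition gram_eigs p r (Z : 'M[R]_(p, r)) : 'rV[R]_r :=
  map_mx (@complex.Re R)
    (spectral_diag (map_mx (real_complex R) (Z^T *m Z))).

Definition sigma p r (Z : 'M[R]_(p, r)) : 'rV[R]_r :=
  \row_j nth 0 (sort >=%R [seq Num.sqrt (gram_eigs Z 0 i) | i <- enum 'I_r]) j.

Lemma gram_eigs_char_poly p r (Z : 'M[R]_(p, r)) :
  char_poly (Z^T *m Z) = \prod_j ('X - (gram_eigs Z 0 j)%:P).
Proof.
pose A := map_mx (real_complex R) (Z^T *m Z).
pose d := spectral_diag A; pose P := spectralmx A.
have AH : A \is hermsymmx.
  apply: realsym_hermsym; last first.
    by apply/mxOverP => i j; rewrite mxE complex_real.
  apply/is_hermitianmxP; rewrite expr0 scale1r map_mx_id //.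
  by rewrite /A map_trmx trmx_mul trmxK.
have dE : d = map_mx (real_complex R) (gram_eigs Z).
  apply/rowP => j; rewrite !mxE RRe_real //.
  exact: (mxOverP (hermitian_spectral_diag_real AH)).
have AE : A = invmx P *m diag_mx d *m P.
  by apply/orthomx_spectralP/hermitian_normalmx.
have Pu : P \in unitmx by exact: spectral_unit.
apply: (@map_poly_inj _ _ (real_complex R)).
rewrite map_char_poly -/A.
have -> : char_poly A = char_poly (diag_mx d).
  rewrite /char_poly; have -> : char_poly_mx A = map_mx polyC (invmx P) *m
      char_poly_mx (diag_mx d) *m map_mx polyC P.
    rewrite /char_poly_mx mulmxBr mulmxBl -!map_mxM -AE; congr (_ - _).
    by rewrite scalar_mxC -mulmxA -map_mxM mulVmx// map_mx1 mulmx1.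
  rewrite !det_mulmx mulrC mulrA -det_mulmx -map_mxM mulmxV //.
  by rewrite map_mx1 det1 mul1r.
rewrite char_poly_trig ?diag_mx_is_trig // rmorph_prod.
apply: eq_bigr => j _; rewrite rmorphB /= map_polyX map_polyC /=.
by rewrite dE !mxE eqxx mulr1n.
Qed.

Lemma mxdot_ge0 p q (A : 'M[R]_(p, q)) : 0 <= mxdot A A.
Proof.
apply: sumr_ge0 => i _; rewrite mxE; apply: sumr_ge0 => j _.
by rewrite mxE -expr2 sqr_ge0.
Qed.

Lemma mxdot_eq0 p q (A : 'M[R]_(p, q)) : mxdot A A = 0 -> A = 0.
Proof.
rewrite /mxdot /mxtrace; under eq_bigr do rewrite mxE.
move=> /eqP; rewrite psumr_eq0 => [/allP A0|i _]; last first.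
  by apply: sumr_ge0 => j _; rewrite mxE -expr2 sqr_ge0.
apply/matrixP => i j; have := A0 j (mem_index_enum j) => /=.
rewrite psumr_eq0 => [/allP/(_ i (mem_index_enum i))/=|k _]; last first.
  by rewrite mxE -expr2 sqr_ge0.
by rewrite mxE -expr2 sqrf_eq0 => /eqP ->; rewrite mxE.
Qed.

Lemma gram_eigs_ge0 p r (Z : 'M[R]_(p, r)) j : 0 <= gram_eigs Z 0 j.
Proof.
set a := gram_eigs Z 0 j.
have : root (char_poly (Z^T *m Z)) a.
  rewrite gram_eigs_char_poly; apply/rootP; rewrite horner_prod.
  by rewrite (bigD1 j) //= !hornerE subrr mul0r.
rewrite -eigenvalue_root_char => /eigenvalueP[v vE v0].
have vv : 0 < mxdot v^T v^T.
  rewrite lt_neqAle mxdot_ge0 andbT eq_sym; apply: contra_neq v0 => /mxdot_eq0.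
  by move=> /(congr1 trmx); rewrite trmxK trmx0.
have : a * mxdot v^T v^T = mxdot (Z *m v^T) (Z *m v^T).
  by rewrite /mxdot trmx_mul trmxK mulmxA -(mulmxA v) vE -scalemxAl mxtraceZ.
by move=> E; rewrite -(pmulr_lge0 _ vv) E mxdot_ge0.
Qed.

Lemma sigma_char_poly p r (Z : 'M[R]_(p, r)) :
  char_poly (Z^T *m Z) = \prod_j ('X - (sigma Z 0 j ^+ 2)%:P).
Proof.
pose s := sort >=%R [seq Num.sqrt (gram_eigs Z 0 i) | i <- enum 'I_r].
have ss : size s = r by rewrite size_sort size_map size_enum_ord.
transitivity (\prod_(x <- s) ('X - (x ^+ 2)%:P)); last first.
  by rewrite (big_nth 0) ss big_mkord; apply: eq_bigr => j _; rewrite mxE.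
have /permPl ps := perm_sort >=%R [seq Num.sqrt (gram_eigs Z 0 i) | i <- enum 'I_r].
rewrite gram_eigs_char_poly (perm_big _ ps) /= big_map big_enum /=.
by apply: eq_bigr => j _; rewrite sqr_sqrtr // gram_eigs_ge0.
Qed.

Lemma sigma_ge0 p r (Z : 'M[R]_(p, r)) j : 0 <= sigma Z 0 j.
Proof.
rewrite mxE; set s := sort _ _.
have [js|js] := ltnP j (size s); last by rewrite nth_default.
have := mem_nth 0 js; rewrite mem_sort => /mapP[i _ ->]; exact: sqrtr_ge0.
Qed.

Lemma sigma_nonincreasing p r (Z : 'M[R]_(p, r)) (i j : 'I_r) :
  (i <= j)%N -> sigma Z 0 j <= sigma Z 0 i.
Proof.
move=> ij; rewrite !mxE; set s := sort _ _.
have ss : size s = r by rewrite size_sort size_map size_enum_ord.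
have so : sorted >=%R s by apply: sort_sorted => x y; exact: ge_total.
have ge_tr : transitive (>=%R : rel R).
  by move=> x y z yx zy; exact: le_trans zy yx.
have ge_re : reflexive (>=%R : rel R) by exact: lexx.
by apply: (sorted_leq_nth ge_tr ge_re 0 so); rewrite ?inE ?ss /=.
Qed.

End SingularValues.

Section Objective.
Context {R : realType} {n m r : nat}.

Definition norm20 p q (Z : 'M[R]_(p, q)) : nat := #|[set j | col j Z != 0]%SET|.

Definition Fmu (f : 'M[R]_(n, m) -> R) (mu : R)
    (x : 'M[R]_(n, r) * 'M[R]_(m, r)) : R :=
  f (x.1 *m x.2^T) + mu / 2 * (frob x.1 ^+ 2 + frob x.2 ^+ 2).

Definition Phi (f : 'M[R]_(n, m) -> R) (lambda mu : R)
    (x : 'M[R]_(n, r) * 'M[R]_(m, r)) : R :=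
  Fmu f mu x + lambda * (norm20 x.1 + norm20 x.2)%N%:R.

End Objective.

(* Main.v *)
Require Import Defs.
From HB Require Import structures.
From mathcomp Require Import all_boot all_order all_algebra.
From mathcomp Require Import all_classical all_reals all_analysis.
From mathcomp Require Import ring lra.

(* Along a direction supported in a single nonzero column, [norm20] is locally
   constant, so a regular subgradient of [Phi] agrees on that column with the
   gradient of [Fmu], and the same holds in the limit.  Writing [G] for the
   gradient of [f] at [U V^T], a critical point thus satisfies
   [G V_j + mu U_j = 0] whenever [U_j != 0] and [G^T U_j + mu V_j = 0] whenever
   [V_j != 0]; since [mu > 0], [U_j = 0] iff [V_j = 0], and then both equations
   hold trivially.  Conversely [norm20] is lower semicontinuous.
   Multiplying the two equations by [U^T] and [V^T] balances the Gram matrices.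
   If a global minimizer had dependent nonzero columns, a Householder reflection
   would kill one of them, in [U] and in [V] at once because the Gram matrices
   agree, without changing [Fmu]. *)

Set Implicit Arguments.
Unset Strict Implicit.
Unset Printing Implicit Defensive.

Import Order.TTheory GRing.Theory Num.Theory.
Import numFieldNormedType.Exports.
Local Open Scope classical_set_scope.
Local Open Scope ring_scope.

(** * Gram matrices, column supports and Householder reflections *)

Section Algebra.
Context {R : realType}.

Lemma mxdotE p q (A B : 'M[R]_(p, q)) :
  mxdot A B = \sum_j \sum_i A i j * B i j.
Proof.
by apply: eq_bigr => j _; rewrite mxE; apply: eq_bigr => i _; rewrite mxE.
Qed.

Lemma mxdotC p q (A B : 'M[R]_(p, q)) : mxdot A B = mxdot B A.
Proof. by rewrite /mxdot -mxtrace_tr trmx_mul trmxK. Qed.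

Lemma mxdot_delta p q (A : 'M[R]_(p, q)) i j : mxdot A (delta_mx i j) = A i j.
Proof.
rewrite mxdotE (bigD1 j) //= (bigD1 i) //= mxE !eqxx mulr1.
rewrite !big1 ?addr0 // => [k kj|k ki].
  by rewrite big1 // => l _; rewrite mxE (negPf kj) andbF mulr0.
by rewrite mxE (negPf ki) mulr0.
Qed.

Lemma frob2 p q (A : 'M[R]_(p, q)) : frob A ^+ 2 = mxdot A A.
Proof. by rewrite sqr_sqrtr // mxdot_ge0. Qed.

Lemma col_neq0P p q (Z : 'M[R]_(p, q)) j :
  reflect (exists i, Z i j != 0) (col j Z != 0).
Proof.
apply: (iffP idP) => [|[i]]; last first.
  by apply: contra_neq => /matrixP/(_ i 0); rewrite !mxE.
move=> /cV0Pn[i]; rewrite mxE => Zij; by exists i.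
Qed.

(** A diagonal Gram entry is the squared norm of its column, so the Gram matrix alone determines
    which columns vanish. *)
Lemma col_neq0_gram p q (Z : 'M[R]_(p, q)) j :
  (col j Z != 0) = ((Z^T *m Z) j j != 0).
Proof.
rewrite (_ : (Z^T *m Z) j j = mxdot (col j Z) (col j Z)); last first.
  by rewrite mxdotE big_ord1 mxE; apply: eq_bigr => i _; rewrite !mxE.
congr negb; apply/eqP/eqP => [->|/mxdot_eq0 //].
by rewrite /mxdot mulmx0 mxtrace0.
Qed.

Lemma norm20_gram p p' q (U : 'M[R]_(p, q)) (V : 'M[R]_(p', q)) :
  U^T *m U = V^T *m V -> norm20 U = norm20 V.
Proof.
by move=> UV; apply: eq_card => j; rewrite !inE !col_neq0_gram UV.
Qed.

Lemma gram_mulmx p p' q s (U : 'M[R]_(p, q)) (V : 'M[R]_(p', q))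
    (H : 'M[R]_(q, s)) :
  U^T *m U = V^T *m V -> (U *m H)^T *m (U *m H) = (V *m H)^T *m (V *m H).
Proof. by move=> UV; rewrite !trmx_mul -!mulmxA (mulmxA U^T) UV -mulmxA. Qed.

Lemma sigma_gram p p' q (U : 'M[R]_(p, q)) (V : 'M[R]_(p', q)) :
  U^T *m U = V^T *m V -> sigma U = sigma V.
Proof. by rewrite /sigma /gram_eigs => ->. Qed.

Section ColumnSelection.
Context {p q : nat} (U : 'M[R]_(p, q)).
Let J := [set j | col j U != 0]%SET.
(** The columns of [S] are the basis vectors indexed by [J]: [U *m S] extracts the nonzero columns
    of [U], and [S *m S^T] is the diagonal projection onto [J]. *)
Let S : 'M[R]_(q, norm20 U) := \matrix_(i, k) (i == enum_val k :> 'I_q)%:R.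

Lemma mul_selection : U *m S *m S^T = U.
Proof.
apply/matrixP => i j; rewrite -mulmxA mxE.
transitivity (\sum_k U i k * ((k == j) && (j \in J))%:R).
  apply: eq_bigr => k _; congr (_ * _); rewrite mxE.
  have [jJ|jJ] := boolP (j \in J).
    rewrite (bigD1 (enum_rank_in jJ j)) //= !mxE enum_rankK_in // eqxx mulr1.
    rewrite big1 ?addr0 ?andbT // => l lj; rewrite !mxE.
    case: (j =P _) => [jl|]; last by rewrite mulr0.
    by case/eqP: lj; apply: enum_val_inj; rewrite enum_rankK_in // -jl.
  rewrite andbF big1 // => l _; rewrite !mxE; case: (j =P _) => [jl|].
    by rewrite jl enum_valP in jJ.
  by rewrite mulr0.
rewrite (bigD1 j) //= eqxx big1 ?addr0 => [|k /negPf->]; last by rewrite mulr0.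
have [|/=] := boolP (j \in J); first by rewrite mulr1.
rewrite inE negbK mulr0 => /eqP/colP/(_ i); by rewrite !mxE.
Qed.

Lemma rank_le_norm20 : (\rank U <= norm20 U)%N.
Proof.
rewrite -{1}mul_selection; apply: leq_trans (mxrankM_maxr _ _) _.
exact: rank_leq_row.
Qed.

(** [U *m S] has more columns than its rank, hence a nonzero kernel vector; multiplying that vector
    by [S] pads it with zeros outside [J]. *)
Lemma dependent_columns : (\rank U < norm20 U)%N ->
  exists c : 'cV[R]_q,
    [/\ U *m c = 0, c != 0 & forall j, col j U = 0 -> c j 0 = 0].
Proof.
move=> rk; have : kermx (U *m S)^T != 0.
  rewrite -mxrank_eq0 mxrank_ker mxrank_tr subn_eq0 -ltnNge.
  exact: leq_ltn_trans (mxrankM_maxl _ _) rk.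
case/rowV0Pn => v /sub_kermxP vK v0; exists (S *m v^T).
have Sinj k : (S *m v^T) (enum_val k) 0 = v 0 k.
  rewrite mxE (bigD1 k) //= !mxE eqxx mul1r big1 ?addr0 // => l lk.
  rewrite !mxE (inj_eq enum_val_inj) eq_sym (negPf lk) mul0r; exact: erefl.
split.
- by apply: trmx_inj; rewrite mulmxA trmx_mul trmxK vK trmx0.
- have /rV0Pn[k vk] := v0; apply/cV0Pn; exists (enum_val k).
  by rewrite Sinj.
- move=> j Uj; rewrite mxE big1 // => k _; rewrite mxE.
  case: eqP => [jk|]; last by rewrite mul0r.
  by have := enum_valP k; rewrite -jk inE Uj eqxx.
Qed.

End ColumnSelection.

Lemma householder q (w : 'cV[R]_q) : w != 0 ->
  let H := 1%:M - (2 / mxdot w w) *: (w *m w^T) in H^T = H /\ H *m H = 1%:M.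
Proof.
move=> w0 H; have HT : H^T = H.
  by rewrite /H linearB linearZ /= trmx1 trmx_mul trmxK.
split => //; have ww : mxdot w w != 0 by apply: contra_neq w0 => /mxdot_eq0.
(* The inner factor [w^T *m w] is a scalar, so the quadratic term in [H *m H] cancels the two linear
   ones. *)
have www : w *m w^T *m (w *m w^T) = mxdot w w *: (w *m w^T).
  rewrite mulmxA -(mulmxA w) [w^T *m w]mx11_scalar -trace_mx11 -/(mxdot w w).
  by rewrite mul_mx_scalar scalemxAl.
rewrite /H mulmxBl mul1mx mulmxBr mulmx1 -scalemxAl -scalemxAr www !scalerA.
rewrite (_ : 2 / _ * _ * _ = 2 / mxdot w w + 2 / mxdot w w); last first.
  by field.
by rewrite scalerDl opprB addrK subrK.
Qed.

Lemma mxdot_mulmx_orth p q (U : 'M[R]_(p, q)) (H : 'M[R]_q) :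
  H *m H^T = 1%:M -> mxdot (U *m H) (U *m H) = mxdot U U.
Proof.
by move=> HH; rewrite /mxdot trmx_mul -mulmxA mxtrace_mulC -!mulmxA HH mulmx1.
Qed.

(* The reflection exchanging a unit kernel vector [c], supported on nonzero
   columns, with a basis vector [e_k] such that [c_k != 0] annihilates column
   [k] and preserves the zero columns. *)
Lemma fewer_columns p q (U : 'M[R]_(p, q)) : (\rank U < norm20 U)%N ->
  exists2 H : 'M[R]_q, H *m H^T = 1%:M & (norm20 (U *m H)%R < norm20 U)%N.
Proof.
move=> /dependent_columns[c0 [Uc0 c0n0 c0U]].
have c0c0 : 0 < mxdot c0 c0.
  rewrite lt_neqAle mxdot_ge0 andbT eq_sym.
  by apply: contra_neq c0n0 => /mxdot_eq0.
pose c := (frob c0)^-1 *: c0.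
have fc0 : frob c0 != 0 by rewrite gt_eqF // sqrtr_gt0.
have Uc : U *m c = 0 by rewrite -scalemxAr Uc0 scaler0.
have cU j : col j U = 0 -> c j 0 = 0 by move=> /c0U cj; rewrite mxE cj mulr0.
have cc : mxdot c c = 1.
  rewrite /mxdot (_ : c^T = (frob c0)^-1 *: c0^T) ?[LHS]linearZ //.
  rewrite -scalemxAl -scalemxAr !mxtraceZ -/(mxdot _ _) -frob2.
  by field.
clearbody c.
have /cV0Pn[k ck] : c != 0.
  apply: contra_eq_neq cc => ->.
  by rewrite /mxdot mulmx0 mxtrace0 eq_sym oner_eq0.
have Uk : col k U != 0 by apply: contra_neq ck => /cU.
pose e : 'cV[R]_q := delta_mx k 0.
(* [U] kills [c] but sends [e] to its nonzero column [k]. *)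
have w0 : e - c != 0.
  rewrite subr_eq0; apply: contra_neq Uk => ec.
  by rewrite colE -/e ec Uc.
have [] := householder w0; set H := _ - _ => HT HH.
have mulH j : H *m delta_mx j 0 =
    delta_mx j 0 - (2 / mxdot (e - c) (e - c) * (e - c) j 0) *: (e - c).
  rewrite mulmxBl mul1mx -scalemxAl -mulmxA -colE [col j _]mx11_scalar.
  by rewrite mul_mx_scalar scalerA 2![in LHS]mxE.
(* Both [e] and [c] are unit vectors and their inner product is [c k 0]. *)
have ww : mxdot (e - c) (e - c) = 2 * (1 - c k 0).
  have -> : mxdot (e - c) (e - c) = mxdot c c - 2 * mxdot c e + mxdot e e.
    rewrite !mxdotE !big_ord1 mulr_sumr -sumrB -big_split /=.
    by apply: eq_bigr => i _; rewrite !mxE; move: (_ && _)%:R => b; ring.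
  by rewrite cc !mxdot_delta mxE !eqxx /=; ring.
have ck1 : 1 - c k 0 != 0.
  by apply: contra_neq w0 => c1; apply: mxdot_eq0; rewrite ww c1 mulr0.
have colUH j : c j 0 = 0 -> col j U = 0 -> col j (U *m H) = 0.
  move=> cj Uj; rewrite colE -mulmxA mulH.
  have -> : (e - c) j 0 = 0.
    rewrite !mxE cj eqxx andbT subr0; case: eqP => [jk|//]. 
    by move: ck; rewrite -jk cj eqxx.
  by rewrite mulr0 scale0r subr0 -colE.
exists H; first by rewrite HT.
apply: proper_card; apply/fintype.properP; split.
  apply/fintype.subsetP => j; rewrite !inE; apply: contra_neq => Uj.
  apply: colUH => //.
  exact: cU.
(* The coefficient of [e - c] in [H *m e] is 1, so [H *m e = c], which [U] annihilates. *)
exists k; rewrite !inE // negbK; apply/eqP.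
rewrite colE -mulmxA mulH ww !mxE !eqxx.
have -> : 2 / (2 * (1 - c k 0)) * (1 - c k 0) = 1 by field.
by rewrite scale1r /e subKr.
Qed.

End Algebra.

(** * Lower limits and entrywise limits of matrices *)

Lemma limf_einf_ge0P (R : realType) (C : choiceType) (T : filteredType C)
    (F : set_system T) (g : T -> R) : Filter F ->
  (0 <= limf_einf (fun y => (g y)%:E) F)%E <->
  forall e, 0 < e -> \forall y \near F, - e <= g y.
Proof.
move=> FF; rewrite limf_einfE; split => [ge0 e e0|ge].
  have /ereal_sup_gt[_ [A FA <-]] : ((- e)%:E <
      ereal_sup [set ereal_inf ((fun y => (g y)%:E) @` V) | V in F])%E.
    by apply: lt_le_trans ge0; rewrite lte_fin oppr_lt0.
  move=> /ltW lte; apply: filterS FA => y Ay.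
  rewrite -lee_fin; apply: le_trans lte _; apply: ereal_inf_lbound.
  by exists y.
apply/lee_addgt0Pr => e e0; rewrite -leeBlDr // sub0e.
(* The set where [- e <= g y] belongs to the filter, so its infimum is one of the candidates in the
   supremum. *)
apply: (@le_trans _ _ (ereal_inf
   ((fun y => (g y)%:E) @` [set y | - e <= g y]))).
  by apply: le_ereal_inf_tmp => _ [y /= ey <-]; rewrite lee_fin.
by apply: ereal_sup_ubound; exists [set y | - e <= g y] => //; exact: ge.
Qed.

Lemma cvg_mx (R : realType) (T : Type) {F : set_system T} {FF : Filter F} p q
    (g : T -> 'M[R]_(p, q)) (l : 'M[R]_(p, q)) :
  (forall i j, g x i j @[x --> F] --> l i j) -> g @ F --> l.
Proof.
move=> gl A [P lP PA].
have : \forall x \near F, forall i j, P i j (g x i j).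
  by apply: filter_forall => i; apply: filter_forall => j; apply: gl; exact: lP.
by apply: filterS => x gP; apply: PA => i j; exact: gP.
Qed.

Lemma cvg_coord (R : realType) (T : Type) {F : set_system T} {FF : Filter F} p q
    (g : T -> 'M[R]_(p, q)) (l : 'M[R]_(p, q)) i j :
  g @ F --> l -> g x i j @[x --> F] --> l i j.
Proof.
move=> gl.
exact: (cvg_comp g (fun M : 'M[R]_(p, q) => M i j) gl
  (@coord_continuous R p q i j l)).
Qed.

Lemma cvg_coord_neq0 (R : realType) (T : Type) {F : set_system T}
    {FF : Filter F} p q (g : T -> 'M[R]_(p, q)) (l : 'M[R]_(p, q)) i j :
  g @ F --> l -> l i j != 0 -> \forall x \near F, g x i j != 0.
Proof. by move=> gl lij; apply: cvgr_neq0 lij; exact: cvg_coord. Qed.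

(** Carries the entrywise identity between subgradients and gradients over to their limits. *)
Lemma cvg_coord_eq (R : realType) (T : Type) {F : set_system T}
    {FF : ProperFilter F} p q (g h : T -> 'M[R]_(p, q)) (a b : 'M[R]_(p, q))
    i j :
  g @ F --> a -> h @ F --> b -> (\forall x \near F, g x i j = h x i j) ->
  a i j = b i j.
Proof.
move=> ga hb gh.
have ga' : g x i j @[x --> F] --> a i j by exact: cvg_coord.
have hb' : h x i j @[x --> F] --> b i j by exact: cvg_coord.
apply: (@norm_cvg_unique R R^o (h x i j @[x --> F])) => //.
by apply: cvg_trans ga'; exact: near_eq_cvg.
Qed.

Lemma cvg_trmx (R : realType) (T : Type) {F : set_system T} {FF : Filter F} p q
    (g : T -> 'M[R]_(p, q)) (l : 'M[R]_(p, q)) :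
  g @ F --> l -> (g x)^T @[x --> F] --> l^T.
Proof.
move=> gl; apply: cvg_mx => i j; rewrite mxE.
under eq_fun do rewrite mxE.
exact: cvg_coord.
Qed.

Lemma cvg_mulmx (R : realType) (T : Type) {F : set_system T} {FF : Filter F} p q s
    (g : T -> 'M[R]_(p, q)) (h : T -> 'M[R]_(q, s))
    (A : 'M[R]_(p, q)) (B : 'M[R]_(q, s)) :
  g @ F --> A -> h @ F --> B -> g x *m h x @[x --> F] --> A *m B.
Proof.
move=> gA hB; apply: cvg_mx => i j; rewrite mxE.
under eq_fun do rewrite mxE.
apply: cvg_big => [|k _]; first exact: add_continuous.
by apply: cvgM; exact: cvg_coord.
Qed.

(** * Differentials of bilinear maps and comparison of norms *)

Section Differential.
Context {R : realType}.

(** Named so that it can carry a bilinear structure, which yields the differential of the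
    factorization map. *)
Definition mulmxT p q s (A : 'M[R]_(p, s)) (B : 'M[R]_(q, s)) := A *m B^T.

Lemma mulmxT_is_bilinear p q s :
  bilinear_for (GRing.Scale.Law.clone _ _ *:%R _)
    (GRing.Scale.Law.clone _ _ *:%R _) (@mulmxT p q s).
Proof.
split=> [B|A] a X Y; first by rewrite /mulmxT /= mulmxDl scalemxAl.
by rewrite /mulmxT linearP /= mulmxDr scalemxAr.
Qed.

HB.instance Definition _ p q s :=
  bilinear_isBilinear.Build R _ _ _ _ _ (@mulmxT p q s)
  (@mulmxT_is_bilinear p q s).

Lemma pairdot_is_bilinear n m r :
  bilinear_for (GRing.Scale.Law.clone _ _ *:%R _)
    (GRing.Scale.Law.clone _ _ *:%R _) (@pairdot R n m r).
Proof.
split=> [z|z] a x y /=; rewrite /pairdot /mxdot /=.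
  rewrite !linearP /= !mulmxDl -!scalemxAl !mxtraceD !mxtraceZ scalerDr.
  by rewrite addrACA.
by rewrite !mulmxDr -!scalemxAr !mxtraceD !mxtraceZ scalerDr addrACA.
Qed.

HB.instance Definition _ n m r :=
  bilinear_isBilinear.Build R _ _ _ _ _ (@pairdot R n m r)
  (@pairdot_is_bilinear n m r).

Lemma is_diff_bilin (U V W : normedModType R) (b : {bilinear U -> V -> W}) p :
  continuous (fun p => b p.1 p.2) ->
  is_diff p (fun q => b q.1 q.2) (fun q => b p.1 q.2 + b q.1 p.2).
Proof.
move=> bc; apply: DiffDef; last by rewrite diff_bilin.
exact: differentiable_bilin.
Qed.

Lemma is_diff_mulmxT p q s (x : 'M[R]_(p, s) * 'M[R]_(q, s)) :
  is_diff x (fun y => y.1 *m y.2^T) (fun h => x.1 *m h.2^T + h.1 *m x.2^T).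
Proof.
apply: (@is_diff_bilin _ _ _ (@mulmxT p q s)) => {}x.
apply: cvg_mulmx; first exact: cvg_fst.
by apply: cvg_trmx; exact: cvg_snd.
Qed.

Lemma pairdotC n m r (x y : 'M[R]_(n, r) * 'M[R]_(m, r)) :
  pairdot x y = pairdot y x.
Proof. by rewrite /pairdot mxdotC [X in _ + X]mxdotC. Qed.

Lemma cvg_mxdot (T : Type) {F : set_system T} {FF : Filter F} p q
    (g h : T -> 'M[R]_(p, q)) (A B : 'M[R]_(p, q)) :
  g @ F --> A -> h @ F --> B -> mxdot (g x) (h x) @[x --> F] --> mxdot A B.
Proof.
move=> gA hB; apply: cvg_big => [|j _]; first exact: add_continuous.
by apply: cvg_coord; apply: cvg_mulmx => //; exact: cvg_trmx.
Qed.

Lemma continuous_pairdot n m r :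
  continuous (fun z : ('M[R]_(n, r) * 'M[R]_(m, r)) *
                      ('M[R]_(n, r) * 'M[R]_(m, r)) => pairdot z.1 z.2).
Proof.
move=> [x y]; apply: (@cvgD R R^o).
  apply: (@cvg_mxdot _ _ _ n r (fun z => z.1.1) (fun z => z.2.1) x.1 y.1).
    exact: (cvg_comp fst fst cvg_fst cvg_fst).
  exact: (cvg_comp snd fst cvg_snd cvg_fst).
apply: (@cvg_mxdot _ _ _ m r (fun z => z.1.2) (fun z => z.2.2) x.2 y.2).
  exact: (cvg_comp fst snd cvg_fst cvg_snd).
exact: (cvg_comp snd snd cvg_snd cvg_snd).
Qed.

(** The map is the bilinear [pairdot] composed with the diagonal; symmetry merges the two terms of
    the product rule. *)
Lemma is_diff_sqr_pairnorm n m r (x : 'M[R]_(n, r) * 'M[R]_(m, r)) :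
  is_diff x (fun y => pairdot y y) (fun h => 2 * pairdot x h).
Proof.
have db : is_diff (x, x) (fun z => pairdot z.1 z.2)
    (fun h => pairdot x h.2 + pairdot h.1 x).
  apply: (@is_diff_bilin _ _ _ (@pairdot R n m r) (x, x)).
  exact: continuous_pairdot.
have := is_diff_comp (is_diff_pair (is_diff_id x) (is_diff_id x)) db.
move=> h; apply: is_diff_eq h _; apply/funext => h /=.
by rewrite [pairdot h x]pairdotC -mulr2n mulr_natl.
Qed.

(** Little-o estimates come in the maximum norm, while subgradients are measured by [pairnorm]; this
    bound passes from the former to the latter. *)
Lemma le_norm_pairnorm n m r (x : 'M[R]_(n, r) * 'M[R]_(m, r)) :
  `|x| <= pairnorm x.
Proof.
have le p q (A : 'M[R]_(p, q)) : `|A| <= frob A.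
  have [->|/mx_norm_neq0[ij A_ij]] := eqVneq `|A| 0; first exact: sqrtr_ge0.
  rewrite [leLHS]A_ij -sqrtr_sqr ler_wsqrtr // mxdotE.
  rewrite (bigD1 ij.2) //= (bigD1 ij.1) //= -expr2 -addrA lerDl.
  rewrite addr_ge0 ?sumr_ge0 // => k _; rewrite ?sumr_ge0 // => *.
    by rewrite -expr2 sqr_ge0.
  by rewrite -expr2 sqr_ge0.
rewrite prod_normE ge_max; apply/andP; split.
  by apply: le_trans (le _ _ _) _; rewrite ler_wsqrtr // lerDl mxdot_ge0.
by apply: le_trans (le _ _ _) _; rewrite ler_wsqrtr // lerDr mxdot_ge0.
Qed.

Lemma pairdotZr n m r t (x y : 'M[R]_(n, r) * 'M[R]_(m, r)) :
  pairdot x (t *: y) = t * pairdot x y.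
Proof. exact: linearZr_LR. Qed.

Lemma pairnorm_gt0 n m r (x : 'M[R]_(n, r) * 'M[R]_(m, r)) :
  x != 0 -> 0 < pairnorm x.
Proof. by rewrite -normr_gt0 => /lt_le_trans; apply; exact: le_norm_pairnorm. Qed.

Lemma pairnormZ n m r t (x : 'M[R]_(n, r) * 'M[R]_(m, r)) :
  0 <= t -> pairnorm (t *: x) = t * pairnorm x.
Proof.
move=> t0; rewrite /pairnorm pairdotZr pairdotC pairdotZr mulrA -expr2.
by rewrite sqrtrM ?sqr_ge0 // sqrtr_sqr ger0_norm.
Qed.

Lemma diff_mxgrad p q (f : 'M[R]_(p, q) -> R) X H :
  differentiable f X -> 'd f X H = mxdot (mxgrad f X) H.
Proof.
move=> df; rewrite [in LHS](matrix_sum_delta H) linear_sum mxdotE exchange_big.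
apply: eq_bigr => i _; rewrite linear_sum; apply: eq_bigr => j _.
by rewrite linearZ /= mxE deriveE // mulrC.
Qed.

End Differential.

(** * The gradient and first-order expansion of [Fmu] *)

Section Objective.
Context {R : realType} {n m r : nat}.
Notation E := ('M[R]_(n, r) * 'M[R]_(m, r))%type.
Context (f : 'M[R]_(n, m) -> R) (mu : R).
Context (f_C1 : C1 f).

Definition gradF (x : E) : E :=
  (mxgrad f (x.1 *m x.2^T) *m x.2 + mu *: x.1,
   (mxgrad f (x.1 *m x.2^T))^T *m x.1 + mu *: x.2).

Lemma is_diff_Fmu (x : E) : is_diff x (Fmu f mu) (pairdot (gradF x)).
Proof.
have df := differentiableP (f_C1.1 (x.1 *m x.2^T)).
have := is_diffD (is_diff_comp (is_diff_mulmxT x) df)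
  (is_diffZ (mu / 2) (is_diff_sqr_pairnorm x)).
have <- : Fmu f mu = (f \o (fun y => y.1 *m y.2^T)) +
    (mu / 2) *: (fun y : E => pairdot y y).
  by apply/funext => y; rewrite /Fmu !frob2.
move=> h; apply: is_diff_eq h _; apply/funext => h /=.
set G := mxgrad f (x.1 *m x.2^T).
transitivity (mxdot G (x.1 *m h.2^T + h.1 *m x.2^T) +
    mu / 2 * (2 * pairdot x h)).
  by rewrite -diff_mxgrad //; exact: f_C1.1.
rewrite /pairdot /mxdot /gradF -/G /=.
(* Cyclicity and transpose invariance of the trace move the factors [x.1] and [x.2] onto [G],
   isolating each component of [h]. *)
have -> : \tr (G^T *m (x.1 *m h.2^T + h.1 *m x.2^T)) =
    \tr ((G *m x.2)^T *m h.1) + \tr ((G^T *m x.1)^T *m h.2).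
  rewrite mulmxDr mxtraceD addrC; congr (_ + _).
    by rewrite mulmxA mxtrace_mulC trmx_mul mulmxA.
  by rewrite -mxtrace_tr !trmx_mul !trmxK -mulmxA mxtrace_mulC -mulmxA.
rewrite ![in RHS]linearD /= ![in RHS]linearZ /= !mulmxDl -!scalemxAl.
rewrite ![in RHS]mxtraceD ![in RHS]mxtraceZ.
by field.
Qed.

Lemma Fmu_expansion (x : E) e : 0 < e -> \forall y \near x,
  `|Fmu f mu y - Fmu f mu x - pairdot (gradF x) (y - x)| <= e * pairnorm (y - x).
Proof.
(* [Fo] is the little-o expansion, based at the limit of the neighbourhood filter, which [lim_id]
   identifies with [x]. *)
have [[[_ Fo]] dF] := is_diff_Fmu x; rewrite dF lim_id // in Fo.
move=> e0; have := (eqaddoP _ _ _ _).1 Fo e e0; apply: filterS => y /= /le_trans.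
rewrite opprD addrA; apply.
by apply: ler_wpM2l; [exact: ltW | exact: le_norm_pairnorm].
Qed.
End Objective.

Lemma cvg_line (R : realType) (V : normedModType R) (x d : V) :
  x + t *: d @[t --> (0 : R)] --> x.
Proof.
rewrite -[X in _ --> X]addr0 -[X in _ + X](scale0r d).
apply: cvgD; first exact: cvg_cst.
exact: (@cvgZr_tmp R V _ _ _ id 0 d cvg_id).
Qed.

(** * Regular subgradients along lines, and local behaviour of [norm20] *)

Section Subdifferential.
Context {R : realType} {n m r : nat}.
Notation E := ('M[R]_(n, r) * 'M[R]_(m, r))%type.
Implicit Types (x v g d : E) (h F : E -> R).

Lemma regular_subdiffP h x v : regular_subdiff h x v <->
  forall e, 0 < e -> \forall y \near x,
    - e * pairnorm (y - x) <= h y - h x - pairdot v (y - x).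
Proof.
apply: (iff_trans (limf_einf_ge0P _ _)); split=> H e e0; have := H e e0.
  rewrite near_withinE; apply: filterS => y.
  (* At [y = x] both sides are 0, so the punctured neighbourhood can be replaced by a full one. *)
  have [->|yx /(_ isT)] := eqVneq y x; last first.
    by rewrite ler_pdivlMr // pairnorm_gt0 // subr_eq0.
  rewrite !subrr /pairnorm /pairdot /mxdot !mulmx0 mxtrace0 addr0.
  by rewrite sqrtr0 mulr0 subrr.
rewrite near_withinE; apply: filterS => y le yx.
by rewrite ler_pdivlMr // pairnorm_gt0 // subr_eq0.
Qed.

(** For small [t > 0] the subgradient bound for [h] and the expansion of [F] estimate the same
    increment, so [t] times the difference of the two pairings is at most two error terms of order
    [t]; divide by [t]. *)
Lemma regular_subdiff_dir_le h F x g v d :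
  (forall e, 0 < e -> \forall y \near x,
    `|F y - F x - pairdot g (y - x)| <= e * pairnorm (y - x)) ->
  regular_subdiff h x v ->
  (\forall t \near (0 : R), h (x + t *: d) - h x = F (x + t *: d) - F x) ->
  pairdot v d <= pairdot g d.
Proof.
move=> dF /regular_subdiffP hv hF; apply/ler_addgt0Pr => e e0.
have nd : 0 <= pairnorm d by exact: sqrtr_ge0.
(* The factor 2 accounts for the two error terms; the added 1 keeps the denominator positive when
   [d = 0]. *)
pose e' := e / (2 * (pairnorm d + 1)).
have e'0 : 0 < e' by rewrite divr_gt0 // mulr_gt0 // ltr_wpDl.
have e'd : 2 * (e' * pairnorm d) <= e.
  have -> : e = e' * (2 * (pairnorm d + 1)).
    by rewrite divfK // gt_eqF // mulr_gt0 // ltr_wpDl.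
  by nra.
have onl (P : E -> Prop) : (\forall y \near x, P y) ->
    \forall t \near (0 : R), P (x + t *: d) by exact: cvg_line.
have [t [t0 Ht]] : exists t : R, 0 < t /\
    [/\ h (x + t *: d) - h x = F (x + t *: d) - F x,
      - e' * pairnorm (x + t *: d - x) <=
        h (x + t *: d) - h x - pairdot v (x + t *: d - x) &
      `|F (x + t *: d) - F x - pairdot g (x + t *: d - x)| <=
        e' * pairnorm (x + t *: d - x)].
  have : \forall t \near (0 : R)^'+, 0 < t /\
    [/\ h (x + t *: d) - h x = F (x + t *: d) - F x,
      - e' * pairnorm (x + t *: d - x) <=
        h (x + t *: d) - h x - pairdot v (x + t *: d - x) &
      `|F (x + t *: d) - F x - pairdot g (x + t *: d - x)| <=
        e' * pairnorm (x + t *: d - x)].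
    near=> t; split; first by near: t; exact: nbhs_right_gt.
    split; near: t; apply: cvg_within.
    - exact: hF.
    - exact: (onl _ (hv _ e'0)).
    - exact: (onl _ (dF _ e'0)).
  by move/filter_ex.
have xtd : x + t *: d - x = t *: d by rewrite [x + _]addrC addrK.
move: Ht; rewrite xtd (pairnormZ _ (ltW t0)) !pairdotZr => -[-> lo].
rewrite ler_norml => /andP[_ hi].
have te := ler_wpM2l (ltW t0) e'd.
by rewrite -(ler_pM2l t0); lra.
Unshelve. all: by end_near.
Qed.

(** A nonzero entry chosen in each nonzero column of [B] eventually stays nonzero in [A t],
    simultaneously for the finitely many columns. *)
Lemma norm20_lsc (T : Type) {G : set_system T} {GG : Filter G} p q
    (A : T -> 'M[R]_(p, q)) (B : 'M[R]_(p, q)) :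
  A @ G --> B -> \forall t \near G, (norm20 B <= norm20 (A t))%N.
Proof.
move=> AB.
have : \forall t \near G, forall j, col j B != 0 -> col j (A t) != 0.
  apply: filter_forall => j.
  have [Bj|/col_neq0P[i Bij]] := eqVneq (col j B) 0.
    by apply: filterE => t.
  have Anz : \forall t \near G, A t i j != 0.
    exact: (cvg_coord_neq0 AB Bij).
  by apply: filterS Anz => t Atij _; apply/col_neq0P; exists i.
apply: filterS => t BA; apply: subset_leq_card.
by apply/fintype.subsetP => j; rewrite !inE; exact: BA.
Qed.

Lemma norm20_line p q (A : 'M[R]_(p, q)) i j : col j A != 0 ->
  \forall t \near (0 : R), norm20 (A + t *: delta_mx i j) = norm20 A.
Proof.
move=> Aj.
have /col_neq0P[k Akj] := Aj.
have At : \forall t \near (0 : R), (A + t *: delta_mx i j) k j != 0.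
  exact: (cvg_coord_neq0 (@cvg_line R _ A (delta_mx i j)) Akj).
apply: filterS At => t Atk; apply: eq_card => l; rewrite !inE.
have [->|lj] := eqVneq l j.
  by rewrite Aj; apply/col_neq0P; exists k.
by congr (_ != 0); apply/colP => a; rewrite !mxE (negPf lj) andbF mulr0 addr0.
Qed.

End Subdifferential.

(** * Critical points of [Phi] are the zeros of [gradF] *)

Section Critical.
Context {R : realType} {n m r : nat}.
Notation E := ('M[R]_(n, r) * 'M[R]_(m, r))%type.
Context (f : 'M[R]_(n, m) -> R) (mu : R).
Context (f_C1 : C1 f) (mu_gt0 : 0 < mu).
Implicit Types (x v d : E).

(** The hypothesis covers both signs of [t], so the one-sided inequality applies to [d] and to its
    opposite. *)
Lemma Phi_subdiff_dir lambda x v d :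
  regular_subdiff (Phi f lambda mu) x v ->
  (\forall t \near (0 : R),
     (norm20 (x + t *: d)%R.1 + norm20 (x + t *: d)%R.2)%N =
     (norm20 x.1 + norm20 x.2)%N) ->
  pairdot v d = pairdot (gradF f mu x) d.
Proof.
move=> xv xd.
have le d' : (\forall t \near (0 : R),
     (norm20 (x + t *: d')%R.1 + norm20 (x + t *: d')%R.2)%N =
     (norm20 x.1 + norm20 x.2)%N) -> pairdot v d' <= pairdot (gradF f mu x) d'.
  move=> xd'; apply: (regular_subdiff_dir_le (F := Fmu f mu) _ xv).
    by move=> e; exact: Fmu_expansion.
  by apply: filterS xd' => t xd'; rewrite /Phi xd' opprD addrACA subrr addr0.
apply/eqP; rewrite eq_le le //=.
have := le (-1 *: d); rewrite !pairdotZr !mulN1r lerN2; apply.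
have neg (P : R -> Prop) :
    (\forall t \near (0 : R), P t) -> \forall t \near (0 : R), P (- t).
  move=> P0; have : -%R @ (0 : R) --> - (0 : R) by exact: opp_continuous.
  by rewrite oppr0; apply.
have xdN := neg _ xd; apply: filterS xdN => t.
by rewrite scalerA mulrN1.
Qed.

Lemma Phi_subdiff1 lambda x v i j : regular_subdiff (Phi f lambda mu) x v ->
  col j x.1 != 0 -> v.1 i j = (gradF f mu x).1 i j.
Proof.
move=> xv xj; have := @Phi_subdiff_dir lambda x v (delta_mx i j, 0) xv.
rewrite /pairdot /= !mxdot_delta /mxdot !mulmx0 mxtrace0 !addr0; apply.
apply: filterS (norm20_line i xj) => t ->.
by rewrite scaler0 addr0.
Qed.

Lemma Phi_subdiff2 lambda x v i j : regular_subdiff (Phi f lambda mu) x v ->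
  col j x.2 != 0 -> v.2 i j = (gradF f mu x).2 i j.
Proof.
move=> xv xj; have := @Phi_subdiff_dir lambda x v (0, delta_mx i j) xv.
rewrite /pairdot /= !mxdot_delta /mxdot !mulmx0 mxtrace0 !add0r; apply.
apply: filterS (norm20_line i xj) => t ->.
by rewrite scaler0 addr0.
Qed.

Lemma cvg_gradF (T : Type) (G : set_system T) (u : T -> E) x : Filter G ->
  u @ G --> x -> gradF f mu (u t) @[t --> G] --> gradF f mu x.
Proof.
move=> GG ux.
have u1 : (u t).1 @[t --> G] --> x.1 by exact: (cvg_comp u fst ux cvg_fst).
have u2 : (u t).2 @[t --> G] --> x.2 by exact: (cvg_comp u snd ux cvg_snd).
have u2T : (u t).2^T @[t --> G] --> x.2^T by exact: (cvg_trmx u2).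
have cX : (u t).1 *m (u t).2^T @[t --> G] --> x.1 *m x.2^T.
  exact: (cvg_mulmx u1 u2T).
have cg : mxgrad f ((u t).1 *m (u t).2^T) @[t --> G] -->
    mxgrad f (x.1 *m x.2^T) := cvg_comp _ (mxgrad f) cX (f_C1.2 _).
have cgT : (mxgrad f ((u t).1 *m (u t).2^T))^T @[t --> G] -->
    (mxgrad f (x.1 *m x.2^T))^T by exact: (cvg_trmx cg).
have g1 : (gradF f mu (u t)).1 @[t --> G] --> (gradF f mu x).1.
  by apply: cvgD; [exact: (cvg_mulmx cg u2) | exact: cvgZl_tmp].
have g2 : (gradF f mu (u t)).2 @[t --> G] --> (gradF f mu x).2.
  by apply: cvgD; [exact: (cvg_mulmx cgT u1) | exact: cvgZl_tmp].
exact: (cvg_pair g1 g2).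
Qed.

(** The value [lambda = 0] is allowed so that the same description also applies to [Fmu]. *)
Lemma crit_Phi lambda : 0 <= lambda ->
  crit (Phi f lambda mu) = [set x : E | gradF f mu x = 0].
Proof.
move=> lambda0; apply/seteqP; split => [x [xk [vk [xkx _ xkv vk0]]]|x /= gx].
  have gxk : gradF f mu (xk a) @[a --> \oo] --> gradF f mu x by exact: cvg_gradF.
  (* Column [j] is eventually nonzero along [xk], where the entries of [vk] and of the gradient
     agree; the former tend to 0. *)
  have g1 i j : col j x.1 != 0 -> (gradF f mu x).1 i j = 0.
    move=> /col_neq0P[k xkj].
    have xk1 : (xk a).1 @[a --> \oo] --> x.1.
      exact: (cvg_comp _ _ xkx cvg_fst).
    have v1 : (vk a).1 @[a --> \oo] --> (0 : 'M[R]_(n, r)).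
      exact: (cvg_comp _ _ vk0 cvg_fst).
    have gk1 : (gradF f mu (xk a)).1 @[a --> \oo] --> (gradF f mu x).1.
      exact: (cvg_comp _ _ gxk cvg_fst).
    have xkn : \forall a \near \oo, (xk a).1 k j != 0.
      exact: (cvg_coord_neq0 xk1 xkj).
    transitivity ((0 : 'M[R]_(n, r)) i j); last by rewrite mxE.
    apply: (cvg_coord_eq gk1 v1).
    apply: filterS xkn => a xka.
    by rewrite (Phi_subdiff1 _ (xkv a)) //; apply/col_neq0P; exists k.
  have g2 i j : col j x.2 != 0 -> (gradF f mu x).2 i j = 0.
    move=> /col_neq0P[k xkj].
    have xk2 : (xk a).2 @[a --> \oo] --> x.2.
      exact: (cvg_comp _ _ xkx cvg_snd).
    have v2 : (vk a).2 @[a --> \oo] --> (0 : 'M[R]_(m, r)).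
      exact: (cvg_comp _ _ vk0 cvg_snd).
    have gk2 : (gradF f mu (xk a)).2 @[a --> \oo] --> (gradF f mu x).2.
      exact: (cvg_comp _ _ gxk cvg_snd).
    have xkn : \forall a \near \oo, (xk a).2 k j != 0.
      exact: (cvg_coord_neq0 xk2 xkj).
    transitivity ((0 : 'M[R]_(m, r)) i j); last by rewrite mxE.
    apply: (cvg_coord_eq gk2 v2).
    apply: filterS xkn => a xka.
    by rewrite (Phi_subdiff2 _ (xkv a)) //; apply/col_neq0P; exists k.
  pose G := mxgrad f (x.1 *m x.2^T).
  have col1 j : col j (gradF f mu x).1 = G *m col j x.2 + mu *: col j x.1.
    by rewrite !colE mulmxDl -mulmxA -scalemxAl.
  have col2 j : col j (gradF f mu x).2 = G^T *m col j x.1 + mu *: col j x.2.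
    by rewrite !colE mulmxDl -mulmxA -scalemxAl.
  (* If only one of the paired columns vanished, the equation of the other would reduce to [mu]
     times a nonzero column being 0. *)
  have x12 j : (col j x.1 == 0) = (col j x.2 == 0).
    apply/idP/idP => /eqP xj.
      apply: contraT => x2j; have gj i := g2 i j x2j.
      have : col j (gradF f mu x).2 = 0.
        by apply/colP => i; have := gj i; rewrite !mxE.
      rewrite col2 xj mulmx0 add0r => /eqP.
      by rewrite scaler_eq0 gt_eqF //= (negPf x2j).
    apply: contraT => x1j; have gj i := g1 i j x1j.
    have : col j (gradF f mu x).1 = 0.
      by apply/colP => i; have := gj i; rewrite !mxE.
    rewrite col1 xj mulmx0 add0r => /eqP.
    by rewrite scaler_eq0 gt_eqF //= (negPf x1j).
  have c1 j : col j (gradF f mu x).1 = 0.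
    have [x1j|/g1 gj] := boolP (col j x.1 == 0).
      rewrite col1 (eqP x1j); move: x1j; rewrite x12 => /eqP ->.
      by rewrite mulmx0 scaler0 addr0.
    by apply/colP => i; have := gj i; rewrite !mxE.
  have c2 j : col j (gradF f mu x).2 = 0.
    have [x2j|/g2 gj] := boolP (col j x.2 == 0).
      rewrite col2 (eqP x2j); move: x2j; rewrite -x12 => /eqP ->.
      by rewrite mulmx0 scaler0 addr0.
    by apply/colP => i; have := gj i; rewrite !mxE.
  rewrite /= [LHS]surjective_pairing; congr (_, _); apply/matrixP => i j.
    by have /colP/(_ i) := c1 j; rewrite [LHS]mxE [RHS]mxE => ->; rewrite mxE.
  by have /colP/(_ i) := c2 j; rewrite [LHS]mxE [RHS]mxE => ->; rewrite mxE.
(* Conversely, 0 is already a regular subgradient at [x]: the linear term of the expansion vanishes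
   and the penalty cannot drop nearby. *)
exists (fun=> x), (fun=> 0).
split; [exact: cvg_cst|exact: cvg_cst| |exact: cvg_cst].
move=> _; apply/regular_subdiffP => e e0.
have n1 : \forall y \near x, (norm20 x.1 <= norm20 y.1)%N.
  have x1 : y.1 @[y --> x] --> x.1 by case: x {gx} => a b; exact: cvg_fst.
  exact: (norm20_lsc x1).
have n2 : \forall y \near x, (norm20 x.2 <= norm20 y.2)%N.
  have x2 : y.2 @[y --> x] --> x.2 by case: x {gx n1} => a b; exact: cvg_snd.
  exact: (norm20_lsc x2).
near=> y.
have : `|Fmu f mu y - Fmu f mu x - pairdot (gradF f mu x) (y - x)| <=
    e * pairnorm (y - x).
  by near: y; exact: Fmu_expansion.
rewrite gx ler_norml mulNr => /andP[+ _] => /le_trans; apply.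
have : lambda * (norm20 x.1 + norm20 x.2)%:R <=
    lambda * (norm20 y.1 + norm20 y.2)%:R.
  by rewrite ler_wpM2l // ler_nat leq_add //; near: y.
by rewrite /Phi; lra.
Unshelve. all: by end_near.
Qed.

End Critical.

(** * Balancedness, and the ranks of global minimizers *)

Lemma Fmu_Phi0 (R : realType) (n m r : nat) (f : 'M[R]_(n, m) -> R) (mu : R) :
  Fmu (r := r) f mu = Phi f 0 mu.
Proof. by apply/funext => x; rewrite /Phi mul0r addr0. Qed.

Lemma gradF_eq0_balanced (R : realType) (n m r : nat)
    (f : 'M[R]_(n, m) -> R) (mu : R) (U : 'M[R]_(n, r)) (V : 'M[R]_(m, r)) :
  0 < mu -> gradF f mu (U, V) = 0 -> U^T *m U = V^T *m V.
Proof.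
move=> mu0 [/= g1 g2]; set G := mxgrad f _ in g1 g2.
have UU : mu *: (U^T *m U) = - (U^T *m G *m V).
  apply/eqP; rewrite -addr_eq0 addrC scalemxAr -mulmxA -mulmxDr g1.
  by rewrite mulmx0.
have VV : mu *: (V^T *m V) = - (V^T *m G^T *m U).
  apply/eqP; rewrite -addr_eq0 addrC scalemxAr -mulmxA -mulmxDr g2.
  by rewrite mulmx0.
apply: (scalerI (lt0r_neq0 mu0)); rewrite UU.
(* The right-hand sides of [UU] and [VV] are transposes of each other, and [V^T *m V] is
   symmetric. *)
rewrite -[RHS]trmxK linearZ /= trmx_mul trmxK VV linearN /=.
by rewrite !trmx_mul !trmxK mulmxA.
Qed.

Lemma global_minimizer_crit (R : realType) (n m r : nat)
    (h : 'M[R]_(n, r) * 'M[R]_(m, r) -> R) x :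
  global_minimizer h x -> crit h x.
Proof.
move=> hx; exists (fun=> x), (fun=> 0).
split; [exact: cvg_cst|exact: cvg_cst| |exact: cvg_cst].
move=> _; apply/regular_subdiffP => e e0; apply: filterE => y.
rewrite (_ : pairdot 0 _ = 0) ?subr0; last exact: linear0l.
apply: (@le_trans _ _ 0); last by rewrite subr_ge0.
by rewrite mulNr oppr_le0; apply: mulr_ge0; [exact: ltW | exact: sqrtr_ge0].
Qed.

(** Multiplying both factors by [H] preserves their product and Frobenius norms, so minimality
    compares column counts only; equal Gram matrices make each total twice the count of the first
    factor. *)
Lemma minimizer_norm20_le (R : realType) (n m r : nat)
    (f : 'M[R]_(n, m) -> R) (lambda mu : R)
    (U : 'M[R]_(n, r)) (V : 'M[R]_(m, r)) (H : 'M[R]_r) :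
  0 < lambda -> global_minimizer (Phi f lambda mu) (U, V) ->
  U^T *m U = V^T *m V -> H *m H^T = 1%:M ->
  (norm20 U <= norm20 (U *m H)%R)%N.
Proof.
move=> lambda0 minUV UV HH; have := minUV (U *m H, V *m H).
rewrite /Phi /Fmu /= trmx_mul mulmxA -(mulmxA U H) HH mulmx1.
rewrite !frob2 !mxdot_mulmx_orth // lerD2l ler_pM2l // ler_nat.
by rewrite -(norm20_gram UV) -(norm20_gram (gram_mulmx H UV)) !addnn leq_double.
Qed.

Theorem proposition2p5 (R : realType) (n m r : nat)
    (r_gt0 : (0 < r)%N) (le_rn : (r <= n)%N) (le_nm : (n <= m)%N)
    (f : 'M[R]_(n, m) -> R) (Lf : R)
    (f_ge0 : forall X, 0 <= f X)
    (f_C1 : C1 f) (f_lip : lipschitz_grad Lf f)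
    (lambda mu : R) (lambda_gt0 : 0 < lambda) (mu_gt0 : 0 < mu) :
  [/\ crit (Phi (r := r) f lambda mu) = crit (Fmu (r := r) f mu),
      (forall (U : 'M[R]_(n, r)) (V : 'M[R]_(m, r)),
         crit (Phi f lambda mu) (U, V) ->
         U^T *m U = V^T *m V /\ sigma U = sigma V) &
      (forall (U : 'M[R]_(n, r)) (V : 'M[R]_(m, r)),
         global_minimizer (Phi f lambda mu) (U, V) ->
         [/\ \rank U = norm20 U, norm20 U = norm20 V & norm20 V = \rank V])].
Proof.
have critE l := @crit_Phi R n m r f mu f_C1 mu_gt0 l.
have balanced U V : crit (Phi (r := r) f lambda mu) (U, V) ->
    U^T *m U = V^T *m V.
  rewrite critE ?ltW // => g0; exact: gradF_eq0_balanced mu_gt0 g0.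
split.
- by rewrite Fmu_Phi0 !critE // ltW.
- by move=> U V /balanced UV; split => //; exact: sigma_gram.
- move=> U V minUV; have UV := balanced _ _ (global_minimizer_crit minUV).
  have le H := minimizer_norm20_le (H := H) lambda_gt0 minUV UV.
  have VU := norm20_gram UV.
  split => //; apply/eqP.
    rewrite eqn_leq rank_le_norm20 leqNgt; apply/negP => /fewer_columns[H HH].
    by rewrite ltnNge le.
  (* Here the reflection is built from [V]; equality of the Gram matrices transfers the lower column
     count to [U *m H]. *)
  rewrite eqn_leq rank_le_norm20 andbT leqNgt; apply/negP => /fewer_columns[H HH].
  by rewrite -(norm20_gram (gram_mulmx H UV)) -VU ltnNge le.
Qed.
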